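(* Let $X\subset\mathbb{R}^n$ be open, $\mathcal{M}\subset\mathcal{J}^2$ a monotonicity cone subequation, and let $F\in C(\mathcal{G})$ be an $\mathcal{M}$-monotone operator with either $\mathcal{G}=\mathcal{J}^2(X)$ or $\mathcal{G}\subsetneq\mathcal{J}^2(X)$ a fiberegular ($\mathcal{M}$-monotone) subequation. Assume that the pair $(F,\mathcal{G})$ satisfies the following regularity condition: for some fixed $J_0\in\operatorname{int}\mathcal{M}$, given $\Omega\Subset X$ and $\eta>0$, there exists $\delta=\delta(\eta,\Omega)>0$ such that $$F(y,J+\eta J_0)\ge F(x,J)\quad\text{for all }J\in\mathcal{G}_x\text{ and all }x,y\in\Omega\text{ with }|x-y|<\delta.$$ Then the $\mathcal{M}$-monotone map $\Theta:X\to\mathscr{K}(\mathcal{J}^2)$ defined by $$\Theta(x):=\{J\in\mathcal{G}_x:F(x,J)\ge0\}$$ is continuous.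
   Context: $\mathcal{S}(n)$ is the space of real symmetric $n\times n$ matrices with its usual partial order; $\mathcal{J}^2=\mathbb{R}\times\mathbb{R}^n\times\mathcal{S}(n)$; $\mathcal{J}^2(X)=X\times\mathcal{J}^2$, and for $\mathcal{G}\subset\mathcal{J}^2(X)$, $\mathcal{G}_x=\{J:(x,J)\in\mathcal{G}\}$. $\Omega\Subset X$ means $\Omega$ is open with compact closure contained in $X$. Subequation: $\mathcal{G}\subset\mathcal{J}^2(X)$ is a subequation on $X$ if for all $x\in X$: (P) $(r,p,A)\in\mathcal{G}_x\Rightarrow(r,p,A+P)\in\mathcal{G}_x$ for all $P\ge0$; (N) $(r,p,A)\in\mathcal{G}_x\Rightarrow(r+s,p,A)\in\mathcal{G}_x$ for all $s\le0$; (T) $\mathcal{G}=\overline{\operatorname{int}\mathcal{G}}$, $\mathcal{G}_x=\overline{\operatorname{int}(\mathcal{G}_x)}$ and $(\operatorname{int}\mathcal{G})_x=\operatorname{int}(\mathcal{G}_x)$. Monotonicity cone subequation: a nonempty closed convex cone $\mathcal{M}\subset\mathcal{J}^2$ with vertex at the origin satisfying (P), (N) and $\mathcal{M}=\overline{\operatorname{int}\mathcal{M}}$. $\mathcal{G}$ is $\mathcal{M}$-monotone if $\mathcal{G}_x+\mathcal{M}\subset\mathcal{G}_x$ for all $x$; $F\in C(\mathcal{G})$ is $\mathcal{M}$-monotone if $F(x,J+J')\ge F(x,J)$ for all $x\in X$, $J\in\mathcal{G}_x$, $J'\in\mathcal{M}$. $\mathscr{K}(\mathcal{J}^2)$ is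 the family of closed subsets of $\mathcal{J}^2$ with the Hausdorff distance $d_{\mathscr{H}}$ induced by the norm $\|(r,p,A)\|=\max\{|r|,|p|,\max_k|\lambda_k(A)|\}$, $\lambda_k(A)$ the eigenvalues of $A$ (with $d_{\mathscr H}\in[0,+\infty]$, $d_{\mathscr{H}}(\emptyset,\emptyset)=0$ and $d_{\mathscr{H}}(\emptyset,A)=+\infty$ for $A\ne\emptyset$). Continuity of $\Theta$ is with respect to $d_{\mathscr{H}}$. A map $\Theta:X\to\mathscr{K}(\mathcal{J}^2)$ is $\mathcal{M}$-monotone if $\Theta(x)+\mathcal{M}\subset\Theta(x)$ for all $x$. $\mathcal{G}$ is fiberegular if $x\mapsto\mathcal{G}_x$ is continuous with respect to $d_{\mathscr{H}}$. *)

(* Defs.v *)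
From HB Require Import structures.
From mathcomp Require Import all_boot all_order all_algebra.
From mathcomp Require Import all_classical all_reals all_analysis.

Set Implicit Arguments.
Unset Strict Implicit.
Unset Printing Implicit Defensive.

Import Order.TTheory GRing.Theory Num.Theory.
Import numFieldNormedType.Exports.

Local Open Scope classical_set_scope.
Local Open Scope ring_scope.

Section SymmetricMatrices.
Variables (R : realType) (n : nat).

Definition symmx : {pred 'M[R]_n} := [pred A | A^T == A].

Fact symmx_submod_closed : submod_closed symmx.
Proof.
split=> [|a A B]; rewrite !inE ?trmx0 // => /eqP hA /eqP hB.
by rewrite linearP /= hA hB.
Qed.

HB.instance Definition _ :=
  GRing.isSubmodClosed.Build _ _ symmx symmx_submod_closed.

Record symM := SymM { symM_val :> 'M[R]_n; _ : symM_val \in symmx }.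

HB.instance Definition _ := [isSub for symM_val].
HB.instance Definition _ := [Choice of symM by <:].
HB.instance Definition _ := [SubChoice_isSubLmodule of symM by <:].

(* topology induced by the inclusion into the space of all square matrices *)
HB.instance Definition _ := Topological.copy symM (initial_topology symM_val).
HB.instance Definition _ := Uniform.copy symM (initial_topology symM_val).
HB.instance Definition _ := PseudoMetric.copy symM (initial_topology symM_val).

(* P >= 0 in the usual partial order of symmetric matrices *)
Definition psd (P : symM) : Prop :=
  forall v : 'rV[R]_n, 0 <= (v *m P *m v^T) 0 0.

End SymmetricMatrices.

Section Jets.
Variables (R : realType) (n : nat).

(* A jet (r, p, A) is the nested pair ((r, p), A); its topology is the product
   topology. *)
Definition jet2 := (R^o * 'rV[R]_n * symM R n)%type.

(* Euclidean norm; the library norm on row vectors is the sup norm. *)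
Definition enorm (p : 'rV[R]_n) : R := Num.sqrt (\sum_(i < n) p 0 i ^+ 2).

(* max_k |lambda_k(A)|: the supremum of a finite set, which is nonempty for
   n > 0; for n = 0 it is sup set0 = 0. *)
Definition max_abs_eigenvalue (A : symM R n) : R :=
  sup [set `|l| | l in [set l : R | eigenvalue A l]].

Definition jnorm (J : jet2) : R :=
  Num.max (Num.max `|J.1.1| (enorm J.1.2)) (max_abs_eigenvalue J.2).

(* inf over the empty set is +oo *)
Definition jdist_to (B : set jet2) (J : jet2) : \bar R :=
  ereal_inf [set (jnorm (J - J'))%:E | J' in B].

(* The outer maximum with 0 only matters when A = B = set0 (where both suprema
   are -oo). *)
Definition hausdorff_dist (A B : set jet2) : \bar R :=
  maxe 0%E (maxe (ereal_sup [set jdist_to B J | J in A])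
                 (ereal_sup [set jdist_to A J | J in B])).

Definition hausdorff_continuous (X : set 'rV[R]_n)
    (Theta : 'rV[R]_n -> set jet2) : Prop :=
  forall x, X x -> forall e : R, 0 < e ->
    \forall y \near within X (nbhs x),
      (hausdorff_dist (Theta x) (Theta y) < e%:E)%E.

Definition propertyP (E : set jet2) : Prop :=
  forall r p A (P : symM R n), psd P -> E (r, p, A) -> E (r, p, A + P).

Definition propertyN (E : set jet2) : Prop :=
  forall r p A (s : R), s <= 0 -> E (r, p, A) -> E (r + s, p, A).

Definition monotonicity_cone (M : set jet2) : Prop :=
  [/\ [/\ M !=set0,
          closed M,
          convex_set (M : set (convex_lmodType jet2))
        & forall (t : R) J, 0 <= t -> M J -> M (t *: J)],
      propertyP M, propertyN M & M = closure M°].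

(* The 2-jet space over X. *)
Definition jet_space (X : set 'rV[R]_n) : set ('rV[R]_n * jet2) := X `*` setT.

(* Interior and closure of G are those relative to the jet space over X. For X
   open, the relative interior is the one in the ambient product, while the
   relative closure is the ambient closure intersected with the jet space. *)
Definition subequation (X : set 'rV[R]_n) (G : set ('rV[R]_n * jet2)) : Prop :=
  [/\ G `<=` jet_space X,
      forall x, X x -> propertyP (xsection G x),
      forall x, X x -> propertyN (xsection G x),
      G = closure G° `&` jet_space X
    & forall x, X x ->
        xsection G x = closure (xsection G x)° /\
        xsection G° x = (xsection G x)°].

Definition monotone_map (X : set 'rV[R]_n) (M : set jet2)
    (Theta : 'rV[R]_n -> set jet2) : Prop :=
  forall x J J', X x -> Theta x J -> M J' -> Theta x (J + J').

Definition fiberegular (X : set 'rV[R]_n) (G : set ('rV[R]_n * jet2)) : Prop :=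
  hausdorff_continuous X (xsection G).

(* An operator on G is a total function of which only the values on G matter. *)
Definition monotone_operator (M : set jet2) (G : set ('rV[R]_n * jet2))
    (F : 'rV[R]_n * jet2 -> R) : Prop :=
  forall x J J', G (x, J) -> M J' -> F (x, J) <= F (x, J + J').

Definition compactly_contained (Om X : set 'rV[R]_n) : Prop :=
  [/\ open Om, compact (closure Om) & closure Om `<=` X].

(* The inequality makes sense only where F is defined, hence the premise
   G (y, J + eta *: J0). When G is M-monotone and either all of the jet space or
   fiberegular, the premise holds automatically for delta small enough. *)
Definition regular_pair (X : set 'rV[R]_n) (M : set jet2)
    (G : set ('rV[R]_n * jet2)) (F : 'rV[R]_n * jet2 -> R) : Prop :=
  exists2 J0 : jet2, M° J0 &
    forall (Om : set 'rV[R]_n) (eta : R), compactly_contained Om X -> 0 < eta ->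
      exists2 delta : R, 0 < delta &
        forall x y J, Om x -> Om y -> enorm (x - y) < delta ->
          G (x, J) -> G (y, J + eta *: J0) ->
          F (x, J) <= F (y, J + eta *: J0).

Definition superlevel_map (G : set ('rV[R]_n * jet2))
    (F : 'rV[R]_n * jet2 -> R) (x : 'rV[R]_n) : set jet2 :=
  [set J | G (x, J) /\ 0 <= F (x, J)].

End Jets.

(* Main.v *)
Require Import Defs.
From mathcomp Require Import all_boot all_order all_algebra.
From mathcomp Require Import all_classical all_reals all_analysis.
From mathcomp Require Import complex spectral ring lra.
Import Order.TTheory GRing.Theory Num.Theory.
Import numFieldNormedType.Exports.
Local Open Scope classical_set_scope.
Local Open Scope ring_scope.

Set Implicit Arguments.
Unset Strict Implicit.
Unset Printing Implicit Defensive.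

(** The single interior direction J0 of M controls everything.  Say that a
    set-valued map Theta is locally translated along J0 when, for every x and
    every t > 0, all y close to x are such that Theta(x) + t J0 is contained in
    Theta(y), and Theta(y) + t J0 in Theta(x).  Such a map is
    Hausdorff continuous ([locally_translates_continuous]): the translation
    moves each jet by the norm of t J0, which is as small as desired, and a
    translate of a nonempty set is nonempty, so that no infinite distance
    between an empty and a nonempty value can occur.

    Conversely an M-monotone continuous map is locally translated along J0
    ([monotone_continuous_translates]): if J lies in Theta(x) and J' in Theta(y)
    is close to J, then J + t J0 = J' + ((J - J') + t J0), and the last term is
    in M because t J0 is interior to M ([interior_cone_absorbs]).  This gives
    the translation property for the fibers of G, trivially so when G is the
    whole jet space.  The regularity condition, applied on a small ball around
    x, says that F does not decrease along these translations, so the property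
    passes to the superlevel sets of F ([superlevel_map_translates]).

    The interior of M is taken in the product topology of jets, whereas
    Hausdorff distances are measured in a norm built from the Euclidean norm
    and the eigenvalues.  The two must be compared both ways.  Eigenvalues are
    bounded by the entries for any matrix ([eigenvalue_le]); the reverse bound
    needs symmetry, and comes from the spectral theorem
    ([symmetric_entry_le]). *)

(** * Entries and eigenvalues of a matrix *)

Lemma unitarymx_entry_le1 (C : numClosedFieldType) (n : nat) (P : 'M[C]_n)
    (i j : 'I_n) :
  P \is unitarymx -> `|P i j| <= 1.
Proof.
move=> /unitarymxP /matrixP /(_ i i).
rewrite !mxE eqxx (eq_bigr (fun k => `|P i k| ^+ 2)); last first.
  by move=> k _; rewrite !mxE -normCK.
rewrite (bigD1 j) //= => PP.
rewrite -(@ler_pXn2r _ 2) ?nnegrE ?ler01 // expr1n -[leRHS]PP lerDl.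
by rewrite sumr_ge0 // => k _; rewrite exprn_ge0.
Qed.

(** Over the complex numbers A = P^* D P with P unitary and D diagonal.  The
    diagonal of D is real and consists of eigenvalues of A, and the entries of
    P have modulus at most 1, so each of the n terms of the sum giving
    [A i j] is at most [c]. *)
Lemma symmetric_entry_le (R : rcfType) (n : nat) (A : 'M[R]_n) (c : R)
    (i j : 'I_n) :
  A^T = A -> (forall l, eigenvalue A l -> `|l| <= c) -> `|A i j| <= n%:R * c.
Proof.
move=> symA Ac.
pose AC : 'M[R[i]]_n := map_mx (real_complex R) A.
have hermAC : AC \is hermsymmx.
  apply/is_hermitianmxP; rewrite expr0 scale1r; apply/matrixP => a b.
  rewrite !mxE -{1}symA mxE.
  by rewrite (CrealP _) //; apply/complex_realP; exists (A b a).
have ACE := orthomx_spectralP (hermitian_normalmx hermAC).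
have unitP := spectral_unitarymx AC.
have realD := hermitian_spectral_diag_real hermAC.
move: ACE unitP realD.
set P := spectralmx AC; set d := spectral_diag AC => ACE unitP realD.
rewrite invmx_unitary // in ACE.
have Dc k : `|d 0 k| <= real_complex R c.
  have /complex_realP[l dl] := mxOverP realD 0 k.
  rewrite dl normc_def /= expr0n addr0 sqrtr_sqr lecR; apply: Ac.
  (* The k-th row of P is an eigenvector for the k-th diagonal entry of D. *)
  suff : eigenvalue AC (d 0 k) by rewrite dl (eigenvalue_map (real_complex R)).
  apply/eigenvalueP; exists (row k P); last first.
    apply/eqP => /(congr1 (mulmx^~ (map_mx Num.conj P^T))).
    rewrite -row_mul (unitarymxP unitP) mul0mx => /rowP /(_ k).
    by rewrite !mxE eqxx => /eqP; rewrite oner_eq0.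
  rewrite -/AC {1}ACE !mulmxA -row_mul (unitarymxP unitP).
  rewrite -mulmxA -row_mul mul1mx row_mul.
  by apply/rowP=> m; rewrite row_diag_mx -scalemxAl -rowE !mxE.
rewrite -lecR rmorphM /= rmorph_nat.
have -> : real_complex R `|A i j| = `|AC i j|.
  by rewrite mxE normc_def /= expr0n addr0 sqrtr_sqr.
rewrite ACE !mxE; apply: le_trans (ler_norm_sum _ _ _) _.
rewrite -[X in _ <= X%:R * _]card_ord -sum1_card natr_sum mulr_suml.
apply: ler_sum => k _; rewrite mul1r mul_mx_diag !mxE !normrM norm_conjC.
rewrite -[leRHS]mul1r -[leRHS]mulr1 !ler_pM //;
  by rewrite ?mulr_ge0 // ?unitarymx_entry_le1.
Qed.

(** Read the eigenvector equation at a coordinate of the eigenvector of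
    largest absolute value. *)
Lemma eigenvalue_le (R : realFieldType) (n : nat) (A : 'M[R]_n) (c l : R) :
  (forall i j, `|A i j| <= c) -> eigenvalue A l -> `|l| <= n%:R * c.
Proof.
move=> Ac /eigenvalueP[v vA v0].
have [j0 vj0] : exists j, v 0 j != 0.
  apply/existsP; rewrite -negb_forall; apply: contra v0 => /forallP v0.
  by apply/eqP/rowP => j; rewrite mxE; apply/eqP.
have [j _ vj] := @arg_maxP _ _ _ j0 xpredT (fun j => `|v 0 j|) isT.
have {}vj k : `|v 0 k| <= `|v 0 j| by exact: vj.
have vj_gt0 : 0 < `|v 0 j|.
  by apply: lt_le_trans (vj j0); rewrite normr_gt0.
rewrite -(ler_pM2r vj_gt0) -normrM.
have -> : l * v 0 j = \sum_i v 0 i * A i j.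
  by have /rowP/(_ j) := vA; rewrite !mxE => ->.
apply: le_trans (ler_norm_sum _ _ _) _.
rewrite -[X in X%:R]card_ord -sum1_card natr_sum !mulr_suml.
apply: ler_sum => k _; rewrite mul1r normrM mulrC.
by rewrite ler_pM.
Qed.

(** * The norm on jets and the product topology *)

Section JetNorm.
Variables (R : realType) (n : nat).
Implicit Types (J K : jet2 R n) (A : symM R n) (p : 'rV[R]_n).

Lemma symM_sym A : (A : 'M[R]_n)^T = A.
Proof. by apply/eqP; case: A. Qed.

Lemma enorm_ge_entry p i : `|p 0 i| <= enorm p.
Proof.
rewrite -sqrtr_sqr ler_sqrt ?sumr_ge0 // => [|k _]; last exact: sqr_ge0.
by rewrite (bigD1 i) //= lerDl sumr_ge0 // => k _; exact: sqr_ge0.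
Qed.

Lemma enorm_le p (c : R) : (forall i, `|p 0 i| <= c) -> enorm p <= n%:R * c.
Proof.
case: n p => [|m] p pc.
  by rewrite /enorm big_ord0 sqrtr0 mul0r.
have c0 : 0 <= c by apply: le_trans (pc 0).
have -> : m.+1%:R * c = Num.sqrt ((m.+1%:R * c) ^+ 2).
  by rewrite sqrtr_sqr ger0_norm // mulr_ge0.
rewrite ler_sqrt ?sqr_ge0 // exprMn.
apply: (@le_trans _ _ (m.+1%:R * c ^+ 2)); last first.
  by rewrite ler_wpM2r ?sqr_ge0 // expr2 ler_peMl // ler1n.
rewrite -[X in _ <= X%:R * _]card_ord -sum1_card natr_sum mulr_suml.
by apply: ler_sum => i _; rewrite mul1r -real_normK ?num_real //
  lerXn2r ?nnegrE.
Qed.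

Lemma max_abs_eigenvalue_le A (c : R) : 0 <= c ->
  (forall i j, `|A i j| <= c) -> max_abs_eigenvalue A <= n%:R * c.
Proof.
move=> c0 Ac; rewrite /max_abs_eigenvalue.
set E := [set _ | _ in _].
have [->|/set0P E0] := eqVneq E set0; first by rewrite sup0 mulr_ge0.
by apply: ge_sup => // _ [l /eigenvalue_le lA <-]; exact: lA.
Qed.

(** The point is that the set of eigenvalues is bounded, without which its
    supremum would be a meaningless default value. *)
Lemma max_abs_eigenvalue_ge A (l : R) :
  eigenvalue A l -> `|l| <= max_abs_eigenvalue A.
Proof.
move=> Al; apply: ub_le_sup; last by exists l.
exists (n%:R * \sum_i \sum_j `|A i j|) => _ [m Am <-].
apply: eigenvalue_le Am => i j.
rewrite (bigD1 i) //= (bigD1 j) //= -addrA lerDl addr_ge0 ?sumr_ge0 //.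
by move=> k _; rewrite sumr_ge0.
Qed.

Lemma max_abs_eigenvalue_ge_entry A i j :
  `|A i j| <= n%:R * max_abs_eigenvalue A.
Proof.
apply: symmetric_entry_le => [|l]; [exact: symM_sym|].
exact: max_abs_eigenvalue_ge.
Qed.

(** Small norm implies small entries.  The factor [t] serves to rescale a
    neighbourhood of [J] to one of [t^-1 *: J]. *)
Lemma jnorm_small_ball J (e t : R) : 0 < e -> 0 < t ->
  exists2 d : R, 0 < d & forall K, jnorm K < d -> ball J e (J + t *: K).
Proof.
move=> e0 t0; pose N : R := n.+1%:R; have N0 : 0 < N by rewrite ltr0n.
exists (e / (t * N)) => [|[[r p] A]]; first by rewrite divr_gt0 // mulr_gt0.
rewrite /jnorm !gt_max /= => /andP[/andP[rd pd] Ad].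
have small (x : R) : `|x| < e / t -> `|t * x| < e.
  by rewrite normrM (gtr0_norm t0) ltr_pdivlMr // mulrC.
have dN : e / (t * N) * N = e / t by rewrite invfM mulrA mulfVK ?gt_eqF.
have dt : e / (t * N) <= e / t.
  by rewrite -dN ler_peMr ?ler1n // divr_ge0 ?mulr_ge0 // ltW.
have ballD (x y : R) : `|y| < e / t -> ball x e (x + t * y).
  by move=> /small ye; rewrite -ball_normE /ball_ /= opprD addNKr normrN.
case: J => [[r0 p0] A0]; split; [split|] => /=.
- by apply: ballD; exact: lt_le_trans dt.
- split=> // i j; rewrite !mxE ord1; apply: ballD.
  by apply: le_lt_trans (enorm_ge_entry p j) _; exact: lt_le_trans dt.
- split=> // i j; rewrite !mxE; apply: ballD.
  apply: le_lt_trans (max_abs_eigenvalue_ge_entry A i j) _.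
  rewrite -dN mulrC.
  have A0' : 0 <= n%:R * max_abs_eigenvalue A.
    exact: le_trans (max_abs_eigenvalue_ge_entry A i j).
  have n0 : (0 < n)%N := leq_ltn_trans (leq0n i) (ltn_ord i).
  rewrite pmulr_rge0 ?ltr0n // in A0'.
  apply: le_lt_trans (_ : _ <= max_abs_eigenvalue A * N) _.
    by rewrite ler_wpM2l // ler_nat.
  by rewrite ltr_pM2r.
Qed.

(** Small entries imply small norm, in the one case of interest: multiples of a
    fixed jet. *)
Lemma jnorm_scale_small J (e : R) : 0 < e ->
  exists2 t : R, 0 < t & jnorm (- (t *: J)) < e.
Proof.
case: J => [[r p] A] e0; pose N : R := n.+1%:R.
have N0 : 0 < N by rewrite ltr0n.
pose S := \sum_i `|p 0 i|; pose T := \sum_i \sum_j `|A i j|.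
have pS i : `|p 0 i| <= S by rewrite /S (bigD1 i) //= lerDl sumr_ge0.
have AT i j : `|A i j| <= T.
  rewrite /T (bigD1 i) //= (bigD1 j) //= -addrA lerDl addr_ge0 ?sumr_ge0 //.
  by move=> k _; rewrite sumr_ge0.
have S0 : 0 <= S by rewrite sumr_ge0.
have T0 : 0 <= T by rewrite sumr_ge0 // => i _; rewrite sumr_ge0.
have r0 := normr_ge0 r.
(* A common bound for all the entries; the 1 makes it positive. *)
pose c : R := 1 + `|r| + S + T.
have rc : `|r| < c by rewrite /c; lra.
have pc i : `|p 0 i| <= c by have := pS i; rewrite /c; lra.
have Ac i j : `|A i j| <= c by have := AT i j; rewrite /c; lra.
have c0 : 0 < c by apply: le_lt_trans rc.
have t0 : 0 < e / (2 * N * c) by rewrite divr_gt0 // !mulr_gt0.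
exists (e / (2 * N * c)) => //.
set t := e / _ in t0 *.
have tc : N * (t * c) < e.
  have -> : N * (t * c) = e / 2.
    by rewrite /t !invfM; field; rewrite !gt_eqF.
  by rewrite ltr_pdivrMr // ltr_pMr // ltr1n.
have scale (x : R) : `|x| <= c -> `|- (t * x)| <= t * c.
  by move=> xc; rewrite normrN normrM (gtr0_norm t0) ler_wpM2l // ltW.
have tc0 : 0 <= t * c by rewrite mulr_ge0 ?ltW.
have nN : n%:R * (t * c) < e.
  by apply: le_lt_trans tc; rewrite ler_wpM2r // ler_nat.
rewrite /jnorm !gt_max; apply/andP; split; [apply/andP; split|].
- apply: le_lt_trans tc; apply: le_trans (scale _ (ltW rc)) _.
  by rewrite ler_peMl // ler1n.
- by apply: le_lt_trans nN; apply: enorm_le => i; rewrite !mxE; exact: scale.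
- apply: le_lt_trans nN; apply: max_abs_eigenvalue_le => // i j.
  by rewrite !mxE; exact: scale.
Qed.

End JetNorm.
(** * Hausdorff distance through nearby points *)

Section HausdorffDistance.
Variables (R : realType) (n : nat).
Implicit Types A B : set (jet2 R n).

Lemma hausdorff_dist_lt A B (e : R) : (hausdorff_dist A B < e%:E)%E ->
  (forall J, A J -> exists2 J', B J' & jnorm (J - J') < e) /\
  (forall J, B J -> exists2 J', A J' & jnorm (J - J') < e).
Proof.
have near_point (C D : set (jet2 R n)) :
    (ereal_sup [set jdist_to D J | J in C] < e%:E)%E ->
    forall J, C J -> exists2 J', D J' & jnorm (J - J') < e.
  move=> CD J CJ.
  have : (jdist_to D J < e%:E)%E.
    by apply: le_lt_trans CD; apply: ereal_sup_ubound; exists J.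
  by case/ereal_inf_lt => _ [J' DJ' <-]; rewrite lte_fin; exists J'.
by rewrite /hausdorff_dist !gt_max => /and3P[_ AB BA]; split; exact: near_point.
Qed.

Lemma hausdorff_dist_le A B (e : R) : 0 <= e ->
  (forall J, A J -> exists2 J', B J' & jnorm (J - J') <= e) ->
  (forall J, B J -> exists2 J', A J' & jnorm (J - J') <= e) ->
  (hausdorff_dist A B <= e%:E)%E.
Proof.
move=> e0 AB BA.
have sup_le (C D : set (jet2 R n)) :
    (forall J, C J -> exists2 J', D J' & jnorm (J - J') <= e) ->
    (ereal_sup [set jdist_to D J | J in C] <= e%:E)%E.
  move=> CD; apply: ge_ereal_sup => _ [J /CD[J' DJ' JJ'] <-].
  apply: ge_ereal_inf; exists (jnorm (J - J'))%:E; first by exists J'.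
  by rewrite lee_fin.
by rewrite /hausdorff_dist !ge_max lee_fin e0 !sup_le.
Qed.

End HausdorffDistance.

(** * Continuity by translation along an interior direction *)

Section Translation.
Variables (R : realType) (n : nat).
Implicit Types (J K : jet2 R n) (X : set 'rV[R]_n) (M : set (jet2 R n)).
Implicit Types Theta : 'rV[R]_n -> set (jet2 R n).

Definition locally_translates X J0 Theta : Prop :=
  forall x, X x -> forall t : R, 0 < t -> \forall y \near within X (nbhs x),
    (forall J, Theta x J -> Theta y (J + t *: J0)) /\
    (forall J, Theta y J -> Theta x (J + t *: J0)).

(** [J] and [J + t *: J0] are at distance [jnorm (- (t *: J0))], whatever [J]
    is, and this tends to 0 with [t]. *)
Lemma locally_translates_continuous X J0 Theta :
  locally_translates X J0 Theta -> hausdorff_continuous X Theta.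
Proof.
move=> trTheta x Xx e e0.
have [t t0 tJ0] := jnorm_scale_small J0 e0.
near=> y.
have [xy yx] : (forall J, Theta x J -> Theta y (J + t *: J0)) /\
    (forall J, Theta y J -> Theta x (J + t *: J0)).
  by near: y; exact: trTheta.
have transl J : jnorm (J - (J + t *: J0)) <= jnorm (- (t *: J0)).
  by rewrite opprD addNKr.
apply: (@le_lt_trans _ _ (jnorm (- (t *: J0)))%:E); last by rewrite lte_fin.
apply: hausdorff_dist_le.
- by rewrite /jnorm !le_max normr_ge0.
- by move=> J /xy; exists (J + t *: J0).
- by move=> J /yx; exists (J + t *: J0).
Unshelve. all: by end_near. Qed.

(** K + t J0 = t (J0 + K / t): the cone property reduces the claim to a
    neighbourhood of [J0]. *)
Lemma interior_cone_absorbs M J0 (t : R) :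
  monotonicity_cone M -> M° J0 -> 0 < t ->
  exists2 d : R, 0 < d & forall K, jnorm K < d -> M (K + t *: J0).
Proof.
move=> [[_ _ _ scaleM] _ _ _] /nbhs_ballP[e e0 eM] t0.
have tV0 : 0 < t^-1 by rewrite invr_gt0.
have [d d0 dball] := jnorm_small_ball J0 e0 tV0.
exists d => // K /dball/eM /(scaleM _ _ (ltW t0)).
by rewrite scalerDr scalerA divff ?gt_eqF // scale1r addrC.
Qed.

(** J + t J0 = J' + ((J - J') + t J0) for a point J' of the other value close
    to J, and M absorbs the small jet J - J'. *)
Lemma monotone_continuous_translates X M J0 Theta :
  monotonicity_cone M -> M° J0 -> monotone_map X M Theta ->
  hausdorff_continuous X Theta -> locally_translates X J0 Theta.
Proof.
move=> coneM MJ0 monT contT x Xx t t0.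
have [d d0 dM] := interior_cone_absorbs coneM MJ0 t0.
near=> y.
have Xy : X y by near: y; exact: withinT.
have /hausdorff_dist_lt[xy yx] :
    (hausdorff_dist (Theta x) (Theta y) < d%:E)%E by near: y; exact: contT.
by split=> J; [move=> /xy[J' TJ' /dM]|move=> /yx[J' TJ' /dM]] => MK;
  rewrite -(subrK J' J) -addrAC addrC; apply: monT.
Unshelve. all: by end_near. Qed.

Lemma open_compactly_contained_nbhs X x : open X -> X x ->
  exists2 Om : set 'rV[R]_n, compactly_contained Om X & Om x.
Proof.
move=> openX Xx.
have /nbhs_closedballP[r rX] : nbhs x X by exact: open_nbhs_nbhs.
exists (ball x r%:num); last exact: ballxx.
split; [exact: ball_open| |exact: rX].
apply: bounded_closed_compact; last exact: closed_closure.
exists (`|x| + r%:num); split; first exact: num_real.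
move=> m mx y; rewrite -/(closed_ball _ _) closed_ballE //.
rewrite /closed_ball_ /= => xy.
apply: le_trans (ltW mx); rewrite -[y](subKr x).
by apply: le_trans (ler_normB _ _) _; rewrite lerD2l.
Qed.

(** The regularity condition compares values of [F] only at points of [G]; the
    translation property of the fibers of [G] provides them. *)
Lemma superlevel_map_translates X J0 (G : set ('rV[R]_n * jet2 R n))
    (F : 'rV[R]_n * jet2 R n -> R) :
  open X -> locally_translates X J0 (xsection G) ->
  (forall (Om : set 'rV[R]_n) (t : R), compactly_contained Om X -> 0 < t ->
     exists2 d : R, 0 < d & forall x y J, Om x -> Om y -> enorm (x - y) < d ->
       G (x, J) -> G (y, J + t *: J0) -> F (x, J) <= F (y, J + t *: J0)) ->
  locally_translates X J0 (superlevel_map G F).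
Proof.
move=> openX trG regF x Xx t t0.
have [Om OmX Omx] := open_compactly_contained_nbhs openX Xx.
have [openOm _ _] := OmX.
have [d d0 regd] := regF _ _ OmX t0.
pose N : R := n.+1%:R; have N0 : 0 < N by rewrite ltr0n.
near=> y.
have Omy : Om y.
  by near: y; apply: cvg_within; exact: open_nbhs_nbhs.
have [xy yx] : (forall J, xsection G x J -> xsection G y (J + t *: J0)) /\
    (forall J, xsection G y J -> xsection G x (J + t *: J0)).
  by near: y; exact: trG.
(* The topology of row vectors is given by the sup norm, the regularity
   condition by the Euclidean norm; the factor N > n compares them. *)
have close : forall i, `|x 0 i - y 0 i| <= d / N.
  have : ball x (d / N) y.
    by near: y; apply: cvg_within; apply: nbhsx_ballx; rewrite divr_gt0.
  by case=> _ + i => /(_ 0 i); rewrite -ball_normE => /ltW.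
have dN : n%:R * (d / N) < d.
  by rewrite mulrA ltr_pdivrMr // mulrC ltr_pM2l // ltr_nat.
have dxy : enorm (x - y) < d.
  by apply: le_lt_trans dN; apply: enorm_le => i; rewrite !mxE.
have dyx : enorm (y - x) < d.
  by apply: le_lt_trans dN; apply: enorm_le => i; rewrite !mxE distrC.
split=> J [GJ FJ].
- have /xsectionP GyJ : xsection G y (J + t *: J0) by apply/xy/xsectionP.
  by split=> //; apply: le_trans FJ _; exact: regd.
- have /xsectionP GxJ : xsection G x (J + t *: J0) by apply/yx/xsectionP.
  by split=> //; apply: le_trans FJ _; exact: regd.
Unshelve. all: by end_near. Qed.

End Translation.

(** * Superlevel sets of the operator *)

(** Since [F] is only continuous within [G], a limit jet must first be placed
    in [G] through closedness of the fiber. *)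
Lemma closed_superlevel_map (R : realType) (n : nat)
    (G : set ('rV[R]_n * jet2 R n)) (F : 'rV[R]_n * jet2 R n -> R)
    (x : 'rV[R]_n) :
  closed (xsection G x) -> {within G, continuous F} ->
  closed (superlevel_map G F x).
Proof.
move=> closedG contF J clJ.
have GJ : G (x, J).
  apply/xsectionP/closedG => U /clJ[K [[GK _] UK]].
  by exists K; split=> //; exact/xsectionP.
split=> //; rewrite leNgt; apply/negP => FJ.
have Fneg : \forall z \near within G (nbhs (x, J)), F z < 0.
  rewrite nbhs_subspace_in //.
  exact: (contF (x, J) _ (lt_nbhsl FJ)).
have [[U V] [/= Ux VJ] UVneg] := Fneg.
have [K [[GK FK] VK]] := clJ V VJ.
have := UVneg (x, K) (conj (nbhs_singleton Ux) VK) GK.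
by rewrite ltNge FK.
Qed.

Theorem theorem7p8 (R : realType) (n : nat) (X : set 'rV[R]_n)
    (M : set (jet2 R n)) (G : set ('rV[R]_n * jet2 R n))
    (F : 'rV[R]_n * jet2 R n -> R)
    (openX : open X)
    (coneM : monotonicity_cone M)
    (G_cases : G = jet_space X \/
       [/\ G `<` jet_space X, subequation X G,
           monotone_map X M (xsection G) & fiberegular X G])
    (contF : {within G, continuous F})
    (monoF : monotone_operator M G F)
    (regFG : regular_pair X M G F) :
  [/\ forall x, X x -> closed (superlevel_map G F x),
      monotone_map X M (superlevel_map G F)
    & hausdorff_continuous X (superlevel_map G F)].
Proof.
have [J0 MJ0 regF] := regFG.
have [closedG monG trG] : [/\ forall x, X x -> closed (xsection G x),
    monotone_map X M (xsection G) & locally_translates X J0 (xsection G)].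
  case: G_cases => [->|[_ [_ _ _ _ fibG] monG contG]].
    have fiber x J : X x -> xsection (jet_space X) x J.
      by move=> Xx; apply/xsectionP.
    split=> [x Xx|x J J' Xx _ _|x Xx t _]; [|exact: fiber|].
      suff -> : xsection (jet_space X) x = setT by exact: closedT.
      by rewrite -subTset => J _; exact: fiber.
    near=> y; have Xy : X y by near: y; exact: withinT.
    by split=> J _; exact: fiber.
  split=> // [x /fibG[-> _]|]; first exact: closed_closure.
  exact: monotone_continuous_translates MJ0 monG contG.
split.
- by move=> x Xx; apply: closed_superlevel_map => //; exact: closedG.
- move=> x J J' Xx [GJ FJ] MJ'; split.
    by apply/xsectionP/monG => //; exact/xsectionP.
  exact: le_trans FJ (monoF _ _ _ GJ MJ').
- apply: (@locally_translates_continuous _ _ _ J0).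
  exact: superlevel_map_translates.
Unshelve. all: by end_near. Qed.
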